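(* Let $G_{m,n} = \langle a, b \mid [a^m, b^n] = 1\rangle$ with integers $m, n \geq 1$. Then $G_{m,n}$ contains an index $m$ normal subgroup isomorphic to $B(S_{m,n})$.
   Context: $\langle A \mid R\rangle$ denotes the group presented by generators $A$ and defining relations $R$; $[x,y]=xyx^{-1}y^{-1}$. For integers $k,\ell\ge 1$, $S_{k,\ell}$ is the directed edge-labelled star graph with vertices $x_0,x_1,\dots,x_k$ and, for each $1\le i\le k$, one directed edge from $x_0$ to $x_i$ labelled $\ell$. The associated group $B(S_{k,\ell})$ is the group with presentation $$B(S_{k,\ell})=\langle x_0,x_1,\dots,x_k \mid [x_0,x_i^{\ell}]=1\ (1\le i\le k)\rangle .$$ *)

(* Defs.v *)
From HB Require Import structures.
From mathcomp Require Import all_boot.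
From mathcomp Require Import boolp classical_sets functions cardinality.

Set Implicit Arguments.
Unset Strict Implicit.
Unset Printing Implicit Defensive.

Local Open Scope classical_set_scope.
Local Open Scope group_scope.
Local Open Scope quotient_scope.

(* A letter (x, true) stands for x and (x, false) for x^-1. *)
Definition word (X : Type) : Type := seq (X * bool).

Definition word_inv (X : Type) (w : word X) : word X :=
  rev [seq (l.1, ~~ l.2) | l <- w].

(* Equality in the free group: the equivalence relation generated by the
   insertion and deletion of subwords x x^-1 and x^-1 x. *)
Inductive free_eq (X : Type) : word X -> word X -> Prop :=
| FreeCancel u v x e : free_eq (u ++ (x, e) :: (x, ~~ e) :: v) (u ++ v)
| FreeRefl u : free_eq u u
| FreeSym u v : free_eq u v -> free_eq v u
| FreeTrans u v w : free_eq u v -> free_eq v w -> free_eq u w.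

Section FreeGroup.
Context (X : choiceType).
Implicit Types u v w : word X.

Lemma free_eq_cat2l u v w : free_eq v w -> free_eq (u ++ v) (u ++ w).
Proof.
elim=> [a b x e|a|a b _ IH|a b c _ IH1 _ IH2].
- by rewrite !catA; exact: FreeCancel.
- exact: FreeRefl.
- exact: FreeSym.
- exact: FreeTrans IH1 IH2.
Qed.

Lemma free_eq_cat2r u v w : free_eq v w -> free_eq (v ++ u) (w ++ u).
Proof.
elim=> [a b x e|a|a b _ IH|a b c _ IH1 _ IH2].
- by rewrite -!catA /=; exact: FreeCancel.
- exact: FreeRefl.
- exact: FreeSym.
- exact: FreeTrans IH1 IH2.
Qed.

Lemma word_inv_cat u v : word_inv (u ++ v) = word_inv v ++ word_inv u.
Proof. by rewrite /word_inv map_cat rev_cat. Qed.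

Lemma free_eq_inv v w : free_eq v w -> free_eq (word_inv v) (word_inv w).
Proof.
elim=> [a b x e|a|a b _ IH|a b c _ IH1 _ IH2].
- have -> : (x, e) :: (x, ~~ e) :: b = [:: (x, e); (x, ~~ e)] ++ b by [].
  rewrite !word_inv_cat -catA.
  have -> : word_inv [:: (x, e); (x, ~~ e)] = [:: (x, e); (x, ~~ e)].
    by rewrite /word_inv /= negbK.
  exact: FreeCancel.
- exact: FreeRefl.
- exact: FreeSym.
- exact: FreeTrans IH1 IH2.
Qed.

Lemma free_eq_mulV w : free_eq (w ++ word_inv w) [::].
Proof.
elim: w => [|[x e] w IH]; first exact: FreeRefl.
rewrite -cat1s word_inv_cat -catA [w ++ _ ++ _]catA.
apply: FreeTrans (free_eq_cat2l _ (free_eq_cat2r _ IH)) _.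
by rewrite /word_inv /=; exact: (@FreeCancel _ [::] [::] x e).
Qed.

Lemma word_invK : involutive (@word_inv X).
Proof.
move=> w; rewrite /word_inv map_rev revK -map_comp -[RHS]map_id.
by apply: eq_map => -[x e] /=; rewrite negbK.
Qed.

Lemma free_eq_Vmul w : free_eq (word_inv w ++ w) [::].
Proof. by rewrite -{2}[w]word_invK; exact: free_eq_mulV. Qed.

Definition free_eqb u v : bool := `[< free_eq u v >].

Lemma free_eqb_refl : reflexive free_eqb.
Proof. by move=> u; apply/asboolP; exact: FreeRefl. Qed.

Lemma free_eqb_sym : symmetric free_eqb.
Proof. by move=> u v; apply/asboolP/asboolP; exact: FreeSym. Qed.

Lemma free_eqb_trans : transitive free_eqb.
Proof.
by move=> v u w /asboolP uv /asboolP vw; apply/asboolP/(FreeTrans uv).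
Qed.

Canonical free_equiv :=
  EquivRel free_eqb free_eqb_refl free_eqb_sym free_eqb_trans.

Definition free_group : Type := {eq_quot free_eqb}.

HB.instance Definition _ := EqQuotient.on free_group.
HB.instance Definition _ := Choice.on free_group.

Definition free_mul (x y : free_group) : free_group :=
  \pi_free_group (repr x ++ repr y).
Definition free_inv (x : free_group) : free_group :=
  \pi_free_group (word_inv (repr x)).
Definition free_one : free_group := \pi_free_group [::].

Lemma free_ind (P : free_group -> Prop) :
  (forall u, P (\pi_free_group u)) -> forall x, P x.
Proof. exact: quotW. Qed.

Lemma free_piP u v :
  reflect (free_eq u v) (\pi_free_group u == \pi_free_group v).
Proof. by rewrite eqmodE; exact: asboolP. Qed.

Lemma free_repr u : free_eq (repr (\pi_free_group u)) u.
Proof. by apply/free_piP; rewrite reprK. Qed.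

Lemma free_piM u v :
  \pi_free_group (u ++ v) = free_mul (\pi_free_group u) (\pi_free_group v).
Proof.
apply/esym/eqP/free_piP; apply: FreeTrans (free_eq_cat2r _ (free_repr u)) _.
exact/free_eq_cat2l/free_repr.
Qed.

Lemma free_piV u : \pi_free_group (word_inv u) = free_inv (\pi_free_group u).
Proof. exact/esym/eqP/free_piP/free_eq_inv/free_repr. Qed.

Lemma free_mulA : associative free_mul.
Proof.
move=> a b c; elim/free_ind: a => u; elim/free_ind: b => v.
by elim/free_ind: c => w; rewrite -!free_piM catA.
Qed.

Lemma free_mul1 : left_id free_one free_mul.
Proof. by move=> a; elim/free_ind: a => u; rewrite -free_piM. Qed.

Lemma free_mulr1 : right_id free_one free_mul.
Proof. by move=> a; elim/free_ind: a => u; rewrite -free_piM cats0. Qed.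

Lemma free_mulVg : left_inverse free_one free_inv free_mul.
Proof.
move=> a; elim/free_ind: a => u; rewrite -free_piV -free_piM.
exact/eqP/free_piP/free_eq_Vmul.
Qed.

Lemma free_mulgV : right_inverse free_one free_inv free_mul.
Proof.
move=> a; elim/free_ind: a => u; rewrite -free_piV -free_piM.
exact/eqP/free_piP/free_eq_mulV.
Qed.

HB.instance Definition _ := isGroup.Build free_group
  free_mulA free_mul1 free_mulr1 free_mulVg free_mulgV.

Lemma free_pi_cat u v :
  \pi_free_group (u ++ v) = \pi_free_group u * \pi_free_group v.
Proof. exact: free_piM. Qed.

Lemma free_pi_inv u : \pi_free_group (word_inv u) = (\pi_free_group u)^-1.
Proof. exact: free_piV. Qed.

Definition free_gen (x : X) : free_group := \pi_free_group [:: (x, true)].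

Section FreeLift.
Context (K : groupType) (f : X -> K).

Definition letter_eval (l : X * bool) : K := if l.2 then f l.1 else (f l.1)^-1.

Definition word_eval (w : word X) : K := \prod_(l <- w) letter_eval l.

Lemma word_eval_cat u v : word_eval (u ++ v) = word_eval u * word_eval v.
Proof. exact: big_cat. Qed.

Lemma word_eval_eq u v : free_eq u v -> word_eval u = word_eval v.
Proof.
elim=> [a b x e|a|a b _ IH|a b c _ IH1 _ IH2].
- rewrite !word_eval_cat /word_eval !big_cons /letter_eval /=.
  by case: e => /=; rewrite ?mulVKg ?mulKg.
- by [].
- by [].
- exact: etrans IH1 IH2.
Qed.

Definition free_lift (x : free_group) : K := word_eval (repr x).

Lemma free_lift_pi u : free_lift (\pi_free_group u) = word_eval u.
Proof. exact/word_eval_eq/free_repr. Qed.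

Lemma free_lift_mul : {morph free_lift : x y / x * y}.
Proof.
move=> a b; elim/free_ind: a => u; elim/free_ind: b => v.
by rewrite -free_pi_cat !free_lift_pi word_eval_cat.
Qed.

HB.instance Definition _ :=
  isMultiplicative.Build free_group K free_lift free_lift_mul.

Lemma free_lift1 : free_lift 1 = 1.
Proof. by rewrite (free_lift_pi [::]) /word_eval big_nil. Qed.

HB.instance Definition _ :=
  Multiplicative_isUMagmaMorphism.Build free_group K free_lift free_lift1.

Lemma free_lift_gen x : free_lift (free_gen x) = f x.
Proof. by rewrite free_lift_pi /word_eval big_seq1. Qed.

End FreeLift.

Lemma free_lift_unique (K : groupType)
    (h : UMagmaMorphism.type free_group K) :
  h =1 free_lift (h \o free_gen).
Proof.
move=> a; elim/free_ind: a => u; rewrite free_lift_pi.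
elim: u => [|[x e] u IH]; first by rewrite /word_eval big_nil; exact: gmulf1.
rewrite -cat1s free_pi_cat gmulfM cat1s IH /word_eval big_cons; congr (_ * _).
rewrite /letter_eval /=; case: e => //=.
by rewrite -gmulfV -free_pi_inv.
Qed.

End FreeGroup.

Definition is_normal (G : groupType) (H : {pred G}) : Prop :=
  forall x y : G, y \in H -> y ^ x \in H.

Section NormalClosure.
Context (G : groupType) (R : set G).

Definition normal_closure : {pred G} := fun x =>
  `[< forall N : groupClosed G,
        is_normal N -> (forall r, R r -> r \in N) -> x \in N >].

Lemma normal_closureP x :
  reflect (forall N : groupClosed G,
             is_normal N -> (forall r, R r -> r \in N) -> x \in N)
          (x \in normal_closure).
Proof. exact: asboolP. Qed.

Lemma normal_closure1 : 1 \in normal_closure.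
Proof. by apply/normal_closureP => N _ _; exact: gpred1. Qed.

Lemma normal_closureM : mulg_closed normal_closure.
Proof.
move=> x y /normal_closureP xN /normal_closureP yN.
by apply/normal_closureP => N nN RN; apply: gpredM; [exact: xN|exact: yN].
Qed.

Lemma normal_closureV : invg_closed normal_closure.
Proof.
move=> x /normal_closureP xN.
by apply/normal_closureP => N nN RN; apply: gpredVr; exact: xN.
Qed.

HB.instance Definition _ := isMulClosed.Build G normal_closure normal_closureM.
HB.instance Definition _ := isMul1Closed.Build G normal_closure normal_closure1.
HB.instance Definition _ := isInvClosed.Build G normal_closure normal_closureV.

Lemma normal_closure_normal : is_normal normal_closure.
Proof.
move=> x y /normal_closureP yN.
by apply/normal_closureP => N nN RN; apply/nN/yN.
Qed.

Lemma normal_closure_sub r : R r -> r \in normal_closure.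
Proof. by move=> Rr; apply/normal_closureP => N _; exact. Qed.

Definition quot_eqb (x y : G) : bool := x^-1 * y \in normal_closure.

Lemma quot_eqb_refl : reflexive quot_eqb.
Proof. by move=> x; rewrite /quot_eqb mulVg gpred1. Qed.

Lemma quot_eqb_sym : symmetric quot_eqb.
Proof. by move=> x y; rewrite /quot_eqb -gpredV invgM invgK. Qed.

Lemma quot_eqb_trans : transitive quot_eqb.
Proof.
move=> y x z xy yz; rewrite /quot_eqb.
by rewrite -[z](mulVKg y) mulgA; exact: gpredM.
Qed.

Canonical quot_equiv :=
  EquivRel quot_eqb quot_eqb_refl quot_eqb_sym quot_eqb_trans.

(* The quotient of G by the normal closure of R. *)
Definition quot_group : Type := {eq_quot quot_eqb}.

HB.instance Definition _ := EqQuotient.on quot_group.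
HB.instance Definition _ := Choice.on quot_group.

Definition quot_mul (x y : quot_group) : quot_group :=
  \pi_quot_group (repr x * repr y).
Definition quot_inv (x : quot_group) : quot_group :=
  \pi_quot_group ((repr x)^-1).
Definition quot_one : quot_group := \pi_quot_group 1.

Lemma quot_ind (P : quot_group -> Prop) :
  (forall x, P (\pi_quot_group x)) -> forall x, P x.
Proof. exact: quotW. Qed.

Lemma quot_piE x y :
  (\pi_quot_group x == \pi_quot_group y) = (x^-1 * y \in normal_closure).
Proof. by rewrite eqmodE. Qed.

Lemma quot_repr x : (repr (\pi_quot_group x))^-1 * x \in normal_closure.
Proof. by rewrite -quot_piE reprK. Qed.

Lemma quot_piM x y :
  \pi_quot_group (x * y) = quot_mul (\pi_quot_group x) (\pi_quot_group y).
Proof.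
apply/esym/eqP; rewrite quot_piE invgM -mulgA.
set a := repr (\pi_quot_group x); set b := repr (\pi_quot_group y).
have -> : b^-1 * (a^-1 * (x * y)) = (a^-1 * x) ^ b * (b^-1 * y).
  by rewrite conjgE -!mulgA mulVKg.
by apply: gpredM; [apply: normal_closure_normal|]; exact: quot_repr.
Qed.

Lemma quot_piV x : \pi_quot_group (x^-1) = quot_inv (\pi_quot_group x).
Proof.
apply/esym/eqP; rewrite quot_piE invgK.
set a := repr _.
have -> : a * x^-1 = ((a^-1 * x)^-1) ^ a^-1.
  by rewrite conjgE invgM !invgK -mulgA mulgV mulg1.
by apply: normal_closure_normal; apply: gpredVr; exact: quot_repr.
Qed.

Lemma quot_mulA : associative quot_mul.
Proof.
move=> a b c; elim/quot_ind: a => x; elim/quot_ind: b => y.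
by elim/quot_ind: c => z; rewrite -!quot_piM mulgA.
Qed.

Lemma quot_mul1 : left_id quot_one quot_mul.
Proof. by move=> a; elim/quot_ind: a => x; rewrite -quot_piM mul1g. Qed.

Lemma quot_mulr1 : right_id quot_one quot_mul.
Proof. by move=> a; elim/quot_ind: a => x; rewrite -quot_piM mulg1. Qed.

Lemma quot_mulVg : left_inverse quot_one quot_inv quot_mul.
Proof.
by move=> a; elim/quot_ind: a => x; rewrite -quot_piV -quot_piM mulVg.
Qed.

Lemma quot_mulgV : right_inverse quot_one quot_inv quot_mul.
Proof.
by move=> a; elim/quot_ind: a => x; rewrite -quot_piV -quot_piM mulgV.
Qed.

HB.instance Definition _ := isGroup.Build quot_group
  quot_mulA quot_mul1 quot_mulr1 quot_mulVg quot_mulgV.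

Definition quot_proj (x : G) : quot_group := \pi_quot_group x.

HB.instance Definition _ :=
  isMultiplicative.Build G quot_group quot_proj quot_piM.
HB.instance Definition _ :=
  Multiplicative_isUMagmaMorphism.Build G quot_group quot_proj erefl.

Lemma quot_projM : {morph quot_proj : x y / x * y}.
Proof. exact: quot_piM. Qed.

Lemma quot_proj1 : quot_proj 1 = 1.
Proof. by []. Qed.

Lemma quot_proj_eq1 x : (quot_proj x == 1) = (x \in normal_closure).
Proof.
rewrite [LHS](_ : _ = (\pi_quot_group x == \pi_quot_group 1)) //.
by rewrite quot_piE mulg1 gpredV.
Qed.

End NormalClosure.

(* The group < X | R > presented by generators X and relators R. *)
Definition presented_group (X : choiceType) (R : set (free_group X)) :
  groupType := quot_group R.

Definition pres_gen (X : choiceType) (R : set (free_group X)) (x : X) :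
  presented_group R := quot_proj R (free_gen x).

(* Von Dyck: a map on generators sending all relators to 1 extends to a morphism
   of the presented group, which pres_lift_unique shows to be unique. *)
Section PresentedLift.
Context (X : choiceType) (R : set (free_group X)) (K : groupType) (f : X -> K).
Context (f_rel : forall r, R r -> free_lift f r = 1).

Definition free_lift_ker : {pred free_group X} := fun x => free_lift f x == 1.

Lemma free_lift_kerM : mulg_closed free_lift_ker.
Proof.
by move=> x y /eqP x1 /eqP y1; apply/eqP; rewrite free_lift_mul x1 y1 mulg1.
Qed.

Lemma free_lift_ker1 : 1 \in free_lift_ker.
Proof. by apply/eqP; exact: free_lift1. Qed.

Lemma free_lift_kerV : invg_closed free_lift_ker.
Proof.
move=> x /eqP x1; apply/eqP.
by rewrite [LHS](gmulfV (free_lift f)) /= x1 invg1.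
Qed.

HB.instance Definition _ :=
  isMulClosed.Build (free_group X) free_lift_ker free_lift_kerM.
HB.instance Definition _ :=
  isMul1Closed.Build (free_group X) free_lift_ker free_lift_ker1.
HB.instance Definition _ :=
  isInvClosed.Build (free_group X) free_lift_ker free_lift_kerV.

Lemma free_lift_closure x : x \in normal_closure R -> free_lift f x = 1.
Proof.
move=> /normal_closureP /(_ free_lift_ker) xN; apply/eqP/xN.
- move=> a b /eqP b1; apply/eqP.
  by rewrite [LHS](gmulfJ (free_lift f)) /= b1 conj1g.
- by move=> r Rr; apply/eqP; exact: f_rel.
Qed.

Definition pres_lift (x : presented_group R) : K := free_lift f (repr x).

Lemma pres_lift_proj x : pres_lift (quot_proj R x) = free_lift f x.
Proof.
have /free_lift_closure := quot_repr R x.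
rewrite free_lift_mul [free_lift f _^-1](gmulfV (free_lift f)) /=.
by move=> /mulg1_eq; rewrite invgK.
Qed.

Lemma pres_lift_mul : {morph pres_lift : x y / x * y}.
Proof.
move=> a b; elim/quot_ind: a => x; elim/quot_ind: b => y.
by rewrite -quot_projM !pres_lift_proj free_lift_mul.
Qed.

HB.instance Definition _ :=
  isMultiplicative.Build (presented_group R) K pres_lift pres_lift_mul.

Lemma pres_lift1 : pres_lift 1 = 1.
Proof. by rewrite -quot_proj1 pres_lift_proj free_lift1. Qed.

HB.instance Definition _ :=
  Multiplicative_isUMagmaMorphism.Build (presented_group R) K
    pres_lift pres_lift1.

Lemma pres_lift_gen x : pres_lift (pres_gen R x) = f x.
Proof. by rewrite pres_lift_proj free_lift_gen. Qed.

Lemma pres_lift_unique (h : UMagmaMorphism.type (presented_group R) K) :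
  (forall x, h (pres_gen R x) = f x) -> h =1 pres_lift.
Proof.
move=> hf a; elim/quot_ind: a => x; rewrite pres_lift_proj.
rewrite -[LHS]/((h \o quot_proj R) x) free_lift_unique.
by apply: eq_bigr => l _; rewrite /letter_eval /= hf.
Qed.

End PresentedLift.

Lemma pres_gen_relator (X : choiceType) (R : set (free_group X)) r :
  R r -> free_lift (pres_gen R) r = 1.
Proof.
move=> Rr; rewrite -(free_lift_unique (quot_proj R)).
by apply/eqP; rewrite quot_proj_eq1; exact: normal_closure_sub.
Qed.

(* The commutator x y x^-1 y^-1; the library's [~ x, y] is x^-1 y^-1 x y. *)
Definition commutator (G : groupType) (x y : G) : G := x * y * x^-1 * y^-1.

(* G_{m,n} = < a, b | [a^m, b^n] >, with a = true and b = false. *)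
Definition Gmn_relators (m n : nat) : set (free_group bool) :=
  [set commutator (free_gen true ^+ m) (free_gen false ^+ n)].

Definition Gmn (m n : nat) : groupType := presented_group (Gmn_relators m n).

(* B(S_{k,l}) = < x_0, ..., x_k | [x_0, x_i^l], 1 <= i <= k >; for i : 'I_k the
   generator lift ord0 i is x_(i+1). *)
Definition Bstar_relators (k l : nat) : set (free_group 'I_k.+1) :=
  range (fun i : 'I_k =>
    commutator (free_gen ord0) (free_gen (lift ord0 i) ^+ l)).

Arguments Bstar_relators : clear implicits.

Definition Bstar (k l : nat) : groupType :=
  presented_group (Bstar_relators k l).

Section Subgroup.
Context (G : groupType) (H : groupClosed G).

Definition subgroup : Type := {x : G | x \in H}.

HB.instance Definition _ := SubChoice.on subgroup.

Lemma subgroup_closed : group_closed H.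
Proof. by split; [exact: gpred1|exact: gpredF]. Qed.

HB.instance Definition _ :=
  SubChoice_isSubGroup.Build G (mem H) subgroup subgroup_closed.

Definition left_coset (x : G) : set G := [set x * h | h in [set` H]].

Definition has_index (m : nat) : Prop := (range left_coset #= `I_m)%card.

End Subgroup.

Definition isomorphic (G K : groupType) : Prop :=
  exists f : {multiplicative G -> K}, bijective f.

(* Main.v *)
From HB Require Import structures.
From mathcomp Require Import all_boot ssralg finalg zmodp.
From mathcomp Require Import classical_sets cardinality zify.
Require Import Defs.

Set Implicit Arguments.
Unset Strict Implicit.
Unset Printing Implicit Defensive.

Import GRing.Theory.
Local Open Scope group_scope.

(** Killing b and a^m maps G = G_(m,n) onto Z/m: a word goes to its exponent
    sum in a.  The subgroup sought is the kernel N (exp_ker) of this map.  The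
    powers 1, a, ..., a^(m-1) are coset representatives of N, so that, by
    Reidemeister and Schreier, N is generated by x_0 = a^m and
    x_(i+1) = a^i b a^(-i) for 0 <= i < m, and the conjugates of the relator
    [a^m, b^n] by the powers of a become the relators [x_0, x_(i+1)^n], the
    relators of B = B(S_{m,n}).

    That no further relator is needed is proved by making G act as the
    rewriting process prescribes.  Right multiplication by a and b on the
    cosets of N, with the Schreier generators recorded in B, is a morphism rho
    from G to the regular wreath product B^(Z/m) x| Z/m:
      a |-> ((1, ..., 1, x_0), 1),   b |-> ((x_1, ..., x_m), 0).
    It respects the relator because the image of a^m is the constant family
    x_0 (wreath_aXm), which commutes with the n-th powers of all the x_(i+1).
    The second component of rho is the exponent sum, and N is its kernel.  On
    N the coordinate of index 0 is multiplicative and gives phi : N -> B.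
    Conversely psi : B -> N sends the generators of B to the Schreier
    generators.  The composite phi o psi fixes the generators of B (psiK); and
    psi o phi is the identity by the identity
      a^i g = psi (rho(g)_i) a^(i + |g|)
    in G (schreier_rewriting), read at i = 0 and g in N. *)

(** * Commutators and induction on presented groups *)

Lemma commutator_eq1 (G : groupType) (x y : G) :
  commutator x y = 1 <-> commute x y.
Proof.
rewrite /commutator /commute; split=> [/(canRL (mulgVK _))|->].
  by rewrite mul1g => /(canRL (mulgVK _)).
by rewrite mulgK mulgV.
Qed.

Lemma gmulf_commutator (G K : groupType) (h : UMagmaMorphism.type G K) :
  {morph h : x y / commutator x y}.
Proof. by move=> x y; rewrite /commutator !gmulfM !gmulfV. Qed.

Lemma commute_conjg (G : groupType) (x y z : G) :
  commute x y -> commute (x ^ z) (y ^ z).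
Proof. by rewrite /commute -!conjMg => ->. Qed.

(** Words are treated one letter at a time, so closure under products and
    inverses is enough. *)
Lemma pres_ind (X : choiceType) (R : set (free_group X))
    (P : presented_group R -> Prop) :
  P 1 -> (forall x y, P x -> P y -> P (x * y)) ->
  (forall x, P x -> P x^-1) -> (forall x, P (pres_gen R x)) ->
  forall x, P x.
Proof.
move=> P1 PM PV Pgen; suff Pproj x : P (quot_proj R x) by elim/quot_ind.
elim/free_ind: x => w; elim: w => [|[x e] w IH]; first exact: P1.
rewrite -cat1s free_pi_cat gmulfM; apply: PM IH.
case: e; first exact: Pgen.
by rewrite (free_pi_inv [:: (x, true)]) gmulfV; apply/PV/Pgen.
Qed.

(** * Regular wreath products *)

Section RegularWreath.
Context (K : groupType) (Z : finZmodType).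

(** A pair (f, s) encodes the monomial matrix over K with rows and columns
    indexed by Z whose row i has the entry f i in column i + s; the group law
    is then the product of matrices. *)
Definition wreath : Type := ({ffun Z -> K} * Z)%type.

HB.instance Definition _ := Choice.on wreath.

Definition wreath_mul (x y : wreath) : wreath :=
  ([ffun i => x.1 i * y.1 (i + x.2)%R], (x.2 + y.2)%R).
Definition wreath_inv (x : wreath) : wreath :=
  ([ffun i => (x.1 (i - x.2)%R)^-1], (- x.2)%R).
Definition wreath_one : wreath := ([ffun=> 1], 0%R).

Lemma wreath_eq (x y : wreath) : x.1 =1 y.1 -> x.2 = y.2 -> x = y.
Proof. by case: x y => [f i] [g j] /= /ffunP -> ->. Qed.

Lemma wreath_mulA : associative wreath_mul.
Proof.
move=> x y z; apply: wreath_eq => [i|] /=; last exact: addrA.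
by rewrite !ffunE mulgA addrA.
Qed.

Lemma wreath_mul1 : left_id wreath_one wreath_mul.
Proof.
by move=> x; apply: wreath_eq => [i|] /=; rewrite ?ffunE ?mul1g ?addr0 ?add0r.
Qed.

Lemma wreath_mulr1 : right_id wreath_one wreath_mul.
Proof.
by move=> x; apply: wreath_eq => [i|] /=; rewrite ?ffunE ?mulg1 ?addr0.
Qed.

Lemma wreath_mulVg : left_inverse wreath_one wreath_inv wreath_mul.
Proof.
by move=> x; apply: wreath_eq => [i|] /=; rewrite ?ffunE ?mulVg ?addNr.
Qed.

Lemma wreath_mulgV : right_inverse wreath_one wreath_inv wreath_mul.
Proof.
by move=> x; apply: wreath_eq => [i|] /=; rewrite ?ffunE ?addrK ?mulgV ?subrr.
Qed.

HB.instance Definition _ := isGroup.Build wreath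
  wreath_mulA wreath_mul1 wreath_mulr1 wreath_mulVg wreath_mulgV.

Lemma wreathM1 (x y : wreath) i : (x * y).1 i = x.1 i * y.1 (i + x.2)%R.
Proof. exact: ffunE. Qed.

Lemma wreathM2 (x y : wreath) : (x * y).2 = (x.2 + y.2)%R.
Proof. by []. Qed.

Lemma wreathV1 (x : wreath) i : (x^-1).1 i = (x.1 (i - x.2)%R)^-1.
Proof. exact: ffunE. Qed.

Lemma wreathV2 (x : wreath) : (x^-1).2 = (- x.2)%R.
Proof. by []. Qed.

Lemma wreathX2 (x : wreath) k : (x ^+ k).2 = (x.2 *+ k)%R.
Proof. by elim: k => [|k IH] //; rewrite expgS mulrS wreathM2 IH. Qed.

Lemma wreathX1 (x : wreath) k i : x.2 = 0%R -> (x ^+ k).1 i = x.1 i ^+ k.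
Proof.
move=> x0; elim: k => [|k IH]; first by rewrite ffunE.
by rewrite !expgS wreathM1 x0 addr0 IH.
Qed.

End RegularWreath.

(** * The kernel of the exponent sum of a modulo m *)

Section ExponentKernel.
Context (m' n : nat).
Local Notation m := m'.+1.
Local Notation G := (Gmn m n).
Local Notation B := (Bstar m n).
Local Notation W := (wreath B 'I_m).

Definition a : G := pres_gen (Gmn_relators m n) true.
Definition b : G := pres_gen (Gmn_relators m n) false.
Definition x0 : B := pres_gen (Bstar_relators m n) ord0.
Definition xS (i : 'I_m) : B := pres_gen (Bstar_relators m n) (lift ord0 i).

Lemma commute_Gmn_gens : commute (a ^+ m) (b ^+ n).
Proof.
apply/commutator_eq1.
have /pres_gen_relator : Gmn_relators m n
  (commutator (free_gen true ^+ m) (free_gen false ^+ n)) by [].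
by rewrite gmulf_commutator !gmulfXn /= !free_lift_gen.
Qed.

Lemma commute_star_gens i : commute x0 (xS i ^+ n).
Proof.
apply/commutator_eq1.
have /pres_gen_relator : Bstar_relators m n
  (commutator (free_gen ord0) (free_gen (lift ord0 i) ^+ n)) by exists i.
by rewrite gmulf_commutator !gmulfXn /= !free_lift_gen.
Qed.

(** The images of a and b: from the coset of a^i, multiplication by a leads to
    that of a^(i+1), with a factor x_0 = a^m only at the last coset, while
    a^i b = x_(i+1) a^i stays in the same coset. *)
Definition wreath_a : W :=
  ([ffun i => if i == ord_max then x0 else 1], inZp 1).

Definition wreath_b : W := ([ffun i => xS i], 0%R).

Lemma wreath_aX2 k : (wreath_a ^+ k).2 = inZp k.
Proof.
by rewrite wreathX2 Zp_mulrn; apply: val_inj; rewrite /= modnMml mul1n.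
Qed.

(** Along k <= m steps from i the last coset is left at most once, and exactly
    when i + k reaches m. *)
Lemma wreath_aX1 k (i : 'I_m) : k <= m ->
  (wreath_a ^+ k).1 i = if i + k < m then 1 else x0.
Proof.
elim: k => [|k IH] km; first by rewrite ffunE addn0 ltn_ord.
rewrite expgSr wreathM1 (IH (ltnW km)) wreath_aX2 ffunE -val_eqE /= modnDmr.
have im := ltn_ord i.
case: (ltnP (i + k) m) => ikm.
  by rewrite mul1g modn_small //; do 2!case: ifP => //; lia.
(* The index has wrapped around: i + k - m < m - 1 since i, k < m. *)
rewrite -(subnK ikm) modnDr modn_small; last lia.
by rewrite ifF ?ifF ?mulg1 //; lia.
Qed.

Lemma wreath_aXm : wreath_a ^+ m = ([ffun=> x0], 0%R).
Proof.
apply: wreath_eq => [i|]; first by rewrite wreath_aX1 // ffunE ifF //; lia.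
by rewrite wreath_aX2; apply: val_inj; rewrite /= modnn.
Qed.

Lemma commute_wreath_gens : commute (wreath_a ^+ m) (wreath_b ^+ n).
Proof.
apply: wreath_eq => [i|]; last by rewrite !wreathM2 addrC.
rewrite wreath_aXm !wreathM1 !wreathX1 // wreathX2 mul0rn !addr0 !ffunE.
exact: commute_star_gens.
Qed.

Definition rho_gen (c : bool) : W := if c then wreath_a else wreath_b.

Lemma rho_rel r : Gmn_relators m n r -> free_lift rho_gen r = 1.
Proof.
move=> ->; rewrite gmulf_commutator !gmulfXn /= !free_lift_gen.
exact/commutator_eq1/commute_wreath_gens.
Qed.

Definition rho : G -> W := pres_lift rho_gen.

HB.instance Definition _ :=
  isMultiplicative.Build G W rho (pres_lift_mul rho_rel).
HB.instance Definition _ :=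
  Multiplicative_isUMagmaMorphism.Build G W rho (pres_lift1 rho_rel).

Lemma rho_a : rho a = wreath_a. Proof. exact: (pres_lift_gen rho_rel). Qed.
Lemma rho_b : rho b = wreath_b. Proof. exact: (pres_lift_gen rho_rel). Qed.

Lemma rho_aX k : rho (a ^+ k) = wreath_a ^+ k.
Proof. by rewrite gmulfXn /= rho_a. Qed.

Lemma rho_conj_b (i : 'I_m) :
  rho (b ^ a ^- i) = wreath_a ^+ i * (wreath_b * wreath_a ^- i).
Proof. by rewrite conjgE invgK !gmulfM gmulfV /= rho_aX rho_b. Qed.

(** Membership says that the exponent sum in a vanishes modulo m. *)
Definition exp_ker : {pred G} := fun g => (rho g).2 == 0%R.

Lemma exp_kerP g : reflect ((rho g).2 = 0%R) (g \in exp_ker).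
Proof. exact: eqP. Qed.

Lemma exp_kerM : mulg_closed exp_ker.
Proof.
move=> x y /exp_kerP xE /exp_kerP yE; apply/exp_kerP.
by rewrite gmulfM wreathM2 xE yE addr0.
Qed.

Lemma exp_ker1 : 1 \in exp_ker. Proof. by apply/exp_kerP; rewrite gmulf1. Qed.

Lemma exp_kerV : invg_closed exp_ker.
Proof.
by move=> x /exp_kerP xE; apply/exp_kerP; rewrite gmulfV wreathV2 xE oppr0.
Qed.

HB.instance Definition _ := isMulClosed.Build G exp_ker exp_kerM.
HB.instance Definition _ := isMul1Closed.Build G exp_ker exp_ker1.
HB.instance Definition _ := isInvClosed.Build G exp_ker exp_kerV.

Lemma exp_ker_normal : is_normal exp_ker.
Proof.
move=> x y /exp_kerP yE; apply/exp_kerP.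
by rewrite gmulfJ conjgE !wreathM2 yE add0r addNr.
Qed.

Lemma rho_aX2 (i : 'I_m) : (rho (a ^+ i)).2 = i.
Proof. by rewrite rho_aX wreath_aX2 valZpK. Qed.

(** The exponent sum of x determines its coset: it is that of a power a^i with
    i < m, and different such powers have different exponent sums. *)
Lemma exp_ker_index : has_index exp_ker m.
Proof.
rewrite /has_index; set L := left_coset _.
have -> : range L = ((fun i => L (a ^+ i)) @` `I_m)%classic.
  apply/seteqP; split=> [_ [x _ <-]|_ [i _ <-]]; last by exists (a ^+ i).
  exists (rho x).2; first by rewrite /= ltn_ord.
  have xa : x^-1 * a ^+ (rho x).2 \in exp_ker.
    by apply/exp_kerP; rewrite gmulfM gmulfV wreathM2 rho_aX2 addNr.
  apply/seteqP; split=> y [h hH <-].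
    exists (x^-1 * a ^+ (rho x).2 * h); first exact: exp_kerM.
    by rewrite -mulgA mulVKg.
  exists ((x^-1 * a ^+ (rho x).2)^-1 * h).
    by apply: exp_kerM => //; exact: exp_kerV.
  by rewrite invgM invgK -!mulgA mulVKg.
apply: inj_card_eq => i j; rewrite !inE => im jm ij.
have : L (a ^+ i) (a ^+ i) by exists 1; [exact: exp_ker1|rewrite mulg1].
rewrite ij => -[h /exp_kerP h0 /(congr1 (fun g => (rho g).2))].
rewrite gmulfM wreathM2 h0 addr0.
by rewrite (rho_aX2 (Ordinal im)) (rho_aX2 (Ordinal jm)) => -[].
Qed.

Lemma aXm_in_ker : a ^+ m \in exp_ker.
Proof. by apply/exp_kerP; rewrite rho_aX wreath_aXm. Qed.

Lemma conj_b_in_ker (i : 'I_m) : b ^ (a ^- i) \in exp_ker.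
Proof. by apply: exp_ker_normal; apply/exp_kerP; rewrite rho_b. Qed.

(** The Schreier generators of the kernel for the representatives a^i. *)
Definition psi_gen (j : 'I_m.+1) : subgroup exp_ker :=
  if unlift ord0 j is Some i then Sub (b ^ (a ^- i)) (conj_b_in_ker i)
  else Sub (a ^+ m) aXm_in_ker.

Lemma psi_rel r : Bstar_relators m n r -> free_lift psi_gen r = 1.
Proof.
move=> [i _ <-]; rewrite gmulf_commutator !gmulfXn /= !free_lift_gen.
apply/commutator_eq1/val_inj; rewrite !gmulfM !gmulfXn /psi_gen.
rewrite unlift_none liftK /= -conjXg.
(* As a^m is fixed by conjugation by a^(-i), the relation wanted is the
   conjugate of the defining relation of G. *)
have aa : (a ^+ m) ^ (a ^- i) = a ^+ m.
  by apply/conjg_fixP/commgP/commuteV; exact: commuteX2.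
rewrite -{1}aa -[in RHS]aa.
exact: commute_conjg commute_Gmn_gens.
Qed.

Definition psi : B -> subgroup exp_ker := pres_lift psi_gen.

HB.instance Definition _ :=
  isMultiplicative.Build B (subgroup exp_ker) psi (pres_lift_mul psi_rel).
HB.instance Definition _ :=
  Multiplicative_isUMagmaMorphism.Build B (subgroup exp_ker) psi
    (pres_lift1 psi_rel).

Lemma psi_x0 : val (psi x0) = a ^+ m.
Proof. by rewrite [psi _](pres_lift_gen psi_rel) /psi_gen unlift_none SubK. Qed.

Lemma psi_xS i : val (psi (xS i)) = b ^ (a ^- i).
Proof. by rewrite [psi _](pres_lift_gen psi_rel) /psi_gen liftK SubK. Qed.

Definition phi (h : subgroup exp_ker) : B := (rho (val h)).1 0%R.

(** On the kernel the shift in the product of the wreath product vanishes. *)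
Lemma phiM : {morph phi : x y / x * y}.
Proof.
move=> x y; rewrite /phi !gmulfM wreathM1.
by have /exp_kerP -> := valP x; rewrite addr0.
Qed.

HB.instance Definition _ :=
  isMultiplicative.Build (subgroup exp_ker) B phi phiM.

Lemma phi1 : phi 1 = 1.
Proof. by rewrite /phi gmulf1 gmulf1 ffunE. Qed.

HB.instance Definition _ :=
  Multiplicative_isUMagmaMorphism.Build (subgroup exp_ker) B phi phi1.

Lemma psiK : cancel psi phi.
Proof.
have gen j : (phi \o psi) (pres_gen (Bstar_relators m n) j) = pres_gen _ j.
  rewrite /= /phi; case: (unliftP ord0 j) => [i|] ->.
    rewrite psi_xS rho_conj_b !wreathM1 wreathV1 !addr0.
    rewrite wreath_aX2 valZpK add0r subrr !wreath_aX1 //; try exact: ltnW.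
    by rewrite add0n ltn_ord invg1 mulg1 mul1g ffunE.
  by rewrite psi_x0 rho_aX wreath_aXm ffunE.
move=> x; rewrite -[LHS]/((phi \o psi) x).
have rel := @pres_gen_relator _ (Bstar_relators m n).
by rewrite (pres_lift_unique rel gen) -(pres_lift_unique rel (h := idfun)).
Qed.

(** Pushing a letter of g at a time through the coset representatives: the set
    of all g for which the identity holds is a subgroup, by shifting the index
    i, and on a and b it is the definition of the Schreier generators. *)
Lemma schreier_rewriting g (i : 'I_m) :
  a ^+ i * g = val (psi ((rho g).1 i)) * a ^+ (i + (rho g).2)%R.
Proof.
move: i; elim/pres_ind: g => [|g h IHg IHh|g IHg|c] i.
- by rewrite gmulf1 ffunE !gmulf1 mulg1 mul1g addr0.
- rewrite !gmulfM wreathM1 wreathM2 !gmulfM mulgA IHg -mulgA IHh.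
  by rewrite mulgA addrA.
- rewrite !gmulfV wreathV1 wreathV2 !gmulfV.
  by apply: (mulIg g); rewrite mulgVK -mulgA IHg subrK mulKg.
case: c.
  rewrite -/a rho_a ffunE -expgSr.
  have -> : val (i + wreath_a.2)%R = i.+1 %% m by rewrite /= modnDmr addn1.
  (* Only from the last coset, of index m - 1, does a lead back to index 0. *)
  case: eqVneq => [->|ne]; first by rewrite psi_x0 modnn mulg1.
  rewrite !gmulf1 mul1g modn_small //.
  by have := ltn_ord i; move: ne; rewrite -val_eqE /=; lia.
by rewrite -/b rho_b ffunE addr0 psi_xS conjgE invgK -!mulgA mulVg mulg1.
Qed.

(** The rewriting identity from the trivial coset back to itself. *)
Lemma phiK : cancel phi psi.
Proof.
move=> h; apply: val_inj.
have := schreier_rewriting (val h) 0%R.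
by have /exp_kerP -> := valP h; rewrite addr0 mul1g mulg1.
Qed.

Lemma exp_ker_isomorphic : isomorphic (subgroup exp_ker) B.
Proof. by exists phi; exists psi; [exact: phiK|exact: psiK]. Qed.

End ExponentKernel.

Theorem theorem3p8 (m n : nat) (hm : 1 <= m) (hn : 1 <= n) :
  exists H : groupClosed (Gmn m n),
    [/\ is_normal H, has_index H m & isomorphic (subgroup H) (Bstar m n)].
Proof.
case: m hm => // m _; exists (@exp_ker m n : groupClosed _).
split; first exact: exp_ker_normal.
- exact: exp_ker_index.
- exact: exp_ker_isomorphic.
Qed.
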